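(* Let $\Lambda$ and, for each $i\in\Lambda$, $\Gamma_i$ be index sets. Let $X$ be a Banach space and $\lambda$ a real number, and suppose that one of the following three statements holds: i) $X$ is isomorphic to $Z=\left(\sum_{i\in\Lambda} c_0(\Gamma_i)\right)_{\ell_\infty}$ and $\lambda>d(X,Z)$; ii) $X$ is isomorphic to $Z=\left(\sum_{i\in\Lambda}\ell_\infty(\Gamma_i)\right)_{c_0}$ and $\lambda>d(X,Z)$; iii) $X=\left(\sum_{i\in\Lambda}E_i\right)_{c_0}$, where $\{E_i\}_{i\in\Lambda}$ is a family of $\lambda$-injective Banach spaces. Then $(X,Y)$ is $(2\lambda,4\lambda)$-stable for every separable Banach space $Y$.
   Context: All Banach spaces are real. $d(X,Z)=\inf\{\|T\|\cdot\|T^{-1}\|: T \text{ is an isomorphism between } X \text{ and } Z\}$ is the Banach-Mazur distance. $\left(\sum_{i\in\Lambda}E_i\right)_{\ell_\infty}$ and $\left(\sum_{i\in\Lambda}E_i\right)_{c_0}$ denote the $\ell_\infty$-sum and the $c_0$-sum of the family $\{E_i\}_{i\in\Lambda}$. A Banach space is $\lambda$-injective if it is $\lambda$-complemented (i.e. the range of a bounded linear projection of norm at most $\lambda$) in every Banach space containing it. A mapping $f:X\to Y$ between Banach spaces is an $\varepsilon$-isometry ($\varepsilon\ge 0$) if $\big|\|f(x)-f(y)\|-\|x-y\|\big|\le\varepsilon$ for all $x,y\in X$; it is standard if $f(0)=0$. Let $L(f)=\overline{\mathrm{span}}\,f(X)\subset Y$. For $\alpha,\gamma>0$, a standard $\varepsilon$-isometry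 $f:X\to Y$ is $(\alpha,\gamma)$-stable if there is a bounded linear operator $T:L(f)\to X$ with $\|T\|\le\alpha$ and $\|Tf(x)-x\|\le\gamma\varepsilon$ for all $x\in X$. The pair $(X,Y)$ is $(\alpha,\gamma)$-stable if for every $\varepsilon\ge0$ every standard $\varepsilon$-isometry $f:X\to Y$ is $(\alpha,\gamma)$-stable. *)

(* Defs.v *)
From HB Require Import structures.
From mathcomp Require Import all_boot all_order all_algebra.
From mathcomp Require Import all_classical all_reals all_analysis.

Set Implicit Arguments.
Unset Strict Implicit.
Unset Printing Implicit Defensive.

Import Order.TTheory GRing.Theory Num.Theory.
Import numFieldNormedType.Exports.

Local Open Scope classical_set_scope.
Local Open Scope ring_scope.

Record closedSubspace (R : realType) (V : normedModType R) := ClosedSubspace {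
  cs_set :> set V ;
  cs_set0 : cs_set 0 ;
  cs_setL : forall (a : R) (u v : V),
    cs_set u -> cs_set v -> cs_set (a *: u + v) ;
  cs_closed : closed cs_set }.

Section ClosedSubspaceType.
Context (R : realType) (V : normedModType R) (S : closedSubspace V).

Definition cs_pred : {pred V} := fun x => x \in cs_set S.

Fact cs_submod_closed : submod_closed cs_pred.
Proof.
split; first by apply/mem_set; exact: cs_set0.
by move=> a u v /set_mem uS /set_mem vS; apply/mem_set; exact: cs_setL.
Qed.

HB.instance Definition _ := GRing.isSubmodClosed.Build R V cs_pred
  (GRing.submod_closed_semi cs_submod_closed).

Record subspaceType := SubspaceType { ss_val : V ; ss_valP : ss_val \in cs_pred }.

HB.instance Definition _ := [isSub for ss_val].
HB.instance Definition _ := [Choice of subspaceType by <:].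
HB.instance Definition _ := [SubChoice_isSubLmodule of subspaceType by <:].

Definition ss_norm (x : subspaceType) : R := `|val x|.

Fact ss_normD x y : ss_norm (x + y) <= ss_norm x + ss_norm y.
Proof. by rewrite /ss_norm raddfD ler_normD. Qed.

Fact ss_normZ (a : R) x : ss_norm (a *: x) = `|a| * ss_norm x.
Proof. by rewrite /ss_norm linearZ normrZ. Qed.

Fact ss_norm0_eq0 x : ss_norm x = 0 -> x = 0.
Proof. by move/normr0_eq0 => x0; apply: val_inj; rewrite raddf0. Qed.

HB.instance Definition _ :=
  Lmodule_isNormed.Build R subspaceType ss_normD ss_normZ ss_norm0_eq0.

Lemma ss_normE (x : subspaceType) : `|x| = `|ss_val x|. Proof. by []. Qed.

End ClosedSubspaceType.

Section ClosedSubspaceComplete.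
Context (R : realType) (V : completeNormedModType R) (S : closedSubspace V).

Fact ss_complete (F : set_system (subspaceType S)) :
  ProperFilter F -> cauchy F -> cvg F.
Proof.
move=> FF Fc.
have vB (x y : subspaceType S) : ss_val x - ss_val y = ss_val (x - y).
  by rewrite -[RHS]/(\val (x - y)) raddfB.
have Gc : cauchy ((@ss_val _ _ S) @ F).
  apply/cauchy_ballP => e e0; move/cauchy_ballP: Fc => /(_ e e0) [[A B] [FA FB] AB].
  exists ((@ss_val _ _ S) @` A, (@ss_val _ _ S) @` B) => /=.
    split; [apply: filterS FA|apply: filterS FB] => z; by exists z.
  move=> [_ _] /= [[x Ax <-] [y By <-]]; rewrite -ball_normE /= vB.
  by have := AB (x, y) (conj Ax By); rewrite -ball_normE.
have /cvg_ex [l Gl] : cvg ((@ss_val _ _ S) @ F) by exact: cauchy_cvg.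
have Sl : l \in cs_pred S.
  apply/mem_set/(@closed_cvg _ _ F _ (@ss_val _ _ S) (cs_set S)) => //.
    exact: cs_closed.
  by apply: nearW => x; exact/set_mem/(ss_valP x).
apply/cvg_ex; exists (SubspaceType Sl); apply/cvgrPdist_lt => e e0.
move/cvgrPdist_lt : Gl => /(_ e e0); apply: filterS => x.
by rewrite -[l]/(ss_val (SubspaceType Sl)) vB.
Qed.

HB.instance Definition _ :=
  Uniform_isComplete.Build (subspaceType S) ss_complete.
End ClosedSubspaceComplete.

Section LinfSum.
Context (R : realType) (I : Type) (E : I -> completeNormedModType R).

Record linf_sum := LinfSum {
  li_val :> forall i, E i ;
  li_bounded : exists M : R, forall i, `|li_val i| <= M }.

HB.instance Definition _ := gen_eqMixin linf_sum.
HB.instance Definition _ := gen_choiceMixin linf_sum.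

Lemma linf_sumP (f g : linf_sum) : (forall i, f i = g i) -> f = g.
Proof.
case: f g => [f bf] [g bg] /= fg; have {}fg := functional_extensionality_dep fg.
by case: _ / fg bg => bg; congr LinfSum; exact: Prop_irrelevance.
Qed.

Fact li_zero_bounded : exists M : R, forall i, `|0 : E i| <= M.
Proof. by exists 0 => i; rewrite normr0. Qed.

Fact li_opp_bounded (f : linf_sum) : exists M : R, forall i, `|- f i| <= M.
Proof. by have [M fM] := li_bounded f; exists M => i; rewrite normrN. Qed.

Fact li_add_bounded (f g : linf_sum) : exists M : R, forall i, `|f i + g i| <= M.
Proof.
have [M fM] := li_bounded f; have [N gN] := li_bounded g; exists (M + N) => i.
by rewrite (le_trans (ler_normD _ _))// lerD.
Qed.

Fact li_scale_bounded (a : R) (f : linf_sum) :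
  exists M : R, forall i, `|a *: f i| <= M.
Proof.
have [M fM] := li_bounded f; exists (`|a| * M) => i.
rewrite normrZ ler_wpM2l; [done|exact: normr_ge0|exact: fM].
Qed.

Definition li_zero := LinfSum li_zero_bounded.
Definition li_opp f := LinfSum (li_opp_bounded f).
Definition li_add f g := LinfSum (li_add_bounded f g).
Definition li_scale a f := LinfSum (li_scale_bounded a f).

Fact li_addA : associative li_add.
Proof. by move=> f g h; apply: linf_sumP => i /=; rewrite addrA. Qed.
Fact li_addC : commutative li_add.
Proof. by move=> f g; apply: linf_sumP => i /=; rewrite addrC. Qed.
Fact li_add0 : left_id li_zero li_add.
Proof. by move=> f; apply: linf_sumP => i /=; rewrite add0r. Qed.
Fact li_addN : left_inverse li_zero li_opp li_add.
Proof. by move=> f; apply: linf_sumP => i /=; rewrite addNr. Qed.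

HB.instance Definition _ :=
  GRing.isZmodule.Build linf_sum li_addA li_addC li_add0 li_addN.

Fact li_scaleA a b f : li_scale a (li_scale b f) = li_scale (a * b) f.
Proof. by apply: linf_sumP => i /=; rewrite scalerA. Qed.
Fact li_scale1 : left_id 1 li_scale.
Proof. by move=> f; apply: linf_sumP => i /=; rewrite scale1r. Qed.
Fact li_scaleDr : right_distributive li_scale +%R.
Proof. by move=> a f g; apply: linf_sumP => i /=; rewrite scalerDr. Qed.
Fact li_scaleDl f : {morph li_scale^~ f : a b / a + b}.
Proof. by move=> a b; apply: linf_sumP => i /=; rewrite scalerDl. Qed.

HB.instance Definition _ := GRing.Zmodule_isLmodule.Build R linf_sum
  li_scaleA li_scale1 li_scaleDr li_scaleDl.

Definition li_norm (f : linf_sum) : R := sup (range (fun i => `|f i|)).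

Fact li_norm_ub (f : linf_sum) i : `|f i| <= li_norm f.
Proof.
apply: ub_le_sup; last by exists i.
by have [M fM] := li_bounded f; exists M => _ [j _ <-].
Qed.

Fact li_norm_ge0 (f : linf_sum) : 0 <= li_norm f.
Proof.
have [[i]|I0] := pselect (inhabited I).
  exact: le_trans (li_norm_ub f i).
suff -> : li_norm f = 0 by [].
rewrite -(@sup0 R); congr sup; apply/seteqP; split => // x [i].
by case: I0.
Qed.

Fact li_norm_le (f : linf_sum) (M : R) : 0 <= M -> (forall i, `|f i| <= M) -> li_norm f <= M.
Proof.
move=> M0 fM; have [[i]|I0] := pselect (inhabited I).
  by apply: ge_sup; [exists `|f i|, i | move=> _ [j _ <-]].
suff -> : li_norm f = 0 by [].
rewrite -(@sup0 R); congr sup; apply/seteqP; split => // x [i].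
by case: I0.
Qed.

Fact li_normD f g : li_norm (f + g) <= li_norm f + li_norm g.
Proof.
apply: li_norm_le => [|i]; first by rewrite addr_ge0// li_norm_ge0.
by rewrite (le_trans (ler_normD _ _))// lerD// li_norm_ub.
Qed.

Fact li_normZ (a : R) f : li_norm (a *: f) = `|a| * li_norm f.
Proof.
have le1 (b : R) g : li_norm (b *: g) <= `|b| * li_norm g.
  apply: li_norm_le => [|i]; first by rewrite mulr_ge0// li_norm_ge0.
  by rewrite normrZ ler_wpM2l// li_norm_ub.
apply/eqP; rewrite eq_le le1/=; have [->|a0] := eqVneq a 0.
  by rewrite normr0 mul0r li_norm_ge0.
rewrite -[in leLHS](scalerK a0 f) mulrC -ler_pdivlMr ?normr_gt0// mulrC.
by rewrite -normfV le1.
Qed.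

Fact li_norm0_eq0 f : li_norm f = 0 -> f = 0.
Proof.
move=> f0; apply: linf_sumP => i; apply/eqP.
by rewrite -normr_le0 -f0 li_norm_ub.
Qed.

HB.instance Definition _ :=
  Lmodule_isNormed.Build R linf_sum li_normD li_normZ li_norm0_eq0.

Lemma linf_sum_normE (f : linf_sum) : `|f| = sup (range (fun i => `|f i|)).
Proof. by []. Qed.

Fact linf_sum_complete (F : set_system linf_sum) :
  ProperFilter F -> cauchy F -> cvg F.
Proof.
move=> FF Fc.
have coordc i : cauchy ((fun f : linf_sum => f i) @ F).
  apply/cauchy_ballP => e e0; move/cauchy_ballP: Fc => /(_ e e0) [[A B] [FA FB] AB].
  exists ((fun f : linf_sum => f i) @` A, (fun f : linf_sum => f i) @` B) => /=.
    split; [apply: filterS FA|apply: filterS FB] => z; by exists z.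
  move=> [_ _] /= [[x Ax <-] [y By <-]].
  have := AB (x, y) (conj Ax By); rewrite -!ball_normE /=.
  exact/le_lt_trans/(li_norm_ub (x - y) i).
have coordl i : exists l : E i, (fun f : linf_sum => f i) @ F --> l.
  by apply/cvg_ex; apply: cauchy_cvg; exact: coordc.
pose l i := projT1 (cid (coordl i)).
have lP i : (fun f : linf_sum => f i) @ F --> l i := projT2 (cid (coordl i)).
have key (e : R) : 0 < e -> \forall f \near F, forall i, `|l i - (f : linf_sum) i| <= e.
  move=> e0; move/cauchy_ballP: Fc => /(_ e e0) [[A B] [FA FB] AB].
  apply: filterS FB => g Bg i.
  have gA : \forall f \near F, `|(f : linf_sum) i - g i| <= e.
    apply: filterS FA => f Af; have := AB (f, g) (conj Af Bg).
    by rewrite -ball_normE /= => /ltW; exact/le_trans/(li_norm_ub (f - g) i).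
  have cf : (fun f : linf_sum => `|f i - g i|) @ F --> `|l i - g i|.
    by apply: cvg_norm; apply: cvgB (lP i) _; exact: cvg_cst.
  exact: (@closed_cvg _ _ F _ _ (fun x => x <= e) (@closed_le R e) gA _ cf).
have lb : exists M : R, forall i, `|l i| <= M.
  have [g lg] := filter_ex (key 1 ltr01).
  have [M gM] := li_bounded g; exists (1 + M) => i.
  by rewrite -(subrK (g i) (l i)) (le_trans (ler_normD _ _))// lerD.
apply/cvg_ex; exists (LinfSum lb); apply/cvgrPdist_le => e e0.
apply: filterS (key e e0) => f fe; apply: li_norm_le; first exact: ltW.
exact: fe.
Qed.

HB.instance Definition _ := Uniform_isComplete.Build linf_sum linf_sum_complete.

End LinfSum.

Section C0Sum.
Context (R : realType) (I : Type) (E : I -> completeNormedModType R).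

Definition vanishing : set (linf_sum E) :=
  [set f | forall e : R, 0 < e -> finite_set [set i | e <= `|f i|]].

Fact vanishing0 : vanishing 0.
Proof.
move=> e e0; apply: sub_finite_set (finite_set0 _) => i /=.
by rewrite normr0 leNgt e0.
Qed.

Fact vanishingL (a : R) (f g : linf_sum E) : vanishing f -> vanishing g -> vanishing (a *: f + g).
Proof.
move=> vf vg e e0.
have a0 : 0 < `|a| + 1 by rewrite ltr_pwDr.
have d0 : 0 < e / 2 / (`|a| + 1) by rewrite !divr_gt0.
have h0 : 0 < e / 2 by rewrite divr_gt0.
have fin : finite_set ([set i | e / 2 / (`|a| + 1) <= `|f i|] `|`
    [set i | e / 2 <= `|g i|]).
  by rewrite finite_setU; split; [exact: vf|exact: vg].
apply: sub_finite_set fin => i /= ei.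
have [fi|fi] := leP (e / 2 / (`|a| + 1)) `|f i|; [by left|right].
rewrite leNgt; apply/negP => gi; move: ei; rewrite leNgt => /negP; apply.
rewrite [e]splitr (le_lt_trans (ler_normD _ _))// normrZ ler_ltD//.
move: fi; rewrite ltr_pdivlMr// => /ltW; apply: le_trans.
by rewrite mulrC ler_wpM2l// lerDl.
Qed.

Fact vanishing_closed : closed vanishing.
Proof.
move=> f clf e e0.
have h0 : 0 < e / 2 by rewrite divr_gt0.
have [g [vg fg]] := clf _ (nbhsx_ballx f _ h0).
apply: sub_finite_set (vg _ h0) => i /= ei.
rewrite leNgt; apply/negP => gi; move: ei; rewrite leNgt => /negP; apply.
move: fg; rewrite -ball_normE /= => fg.
rewrite -(subrK (g i) (f i)) [e]splitr (le_lt_trans (ler_normD _ _))// ltrD//.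
exact: le_lt_trans (li_norm_ub (f - g) i) fg.
Qed.

Definition c0_subspace : closedSubspace (linf_sum E) :=
  ClosedSubspace vanishing0 vanishingL vanishing_closed.

Definition c0_sum : completeNormedModType R := subspaceType c0_subspace.

End C0Sum.

Definition linf (R : realType) (G : Type) : completeNormedModType R :=
  linf_sum (fun _ : G => R^o).

Definition c0 (R : realType) (G : Type) : completeNormedModType R :=
  c0_sum (fun _ : G => R^o).

(* Meaningful for continuous T only: [sup] of an unbounded set is 0. *)
Definition opnorm (R : realType) (V W : normedModType R)
    (T : {linear V -> W}) : R :=
  sup [set `|T x| | x in [set x : V | `|x| <= 1]].

Definition isomorphism (R : realType) (V W : normedModType R)
    (T : {linear V -> W}) (S : {linear W -> V}) : Prop :=
  [/\ cancel T S, cancel S T, continuous T & continuous S].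

Definition isomorphic (R : realType) (V W : normedModType R) : Prop :=
  exists (T : {linear V -> W}) (S : {linear W -> V}), isomorphism T S.

(* Meaningful for isomorphic spaces only: [inf] of the empty set is 0. *)
Definition BMdist (R : realType) (V W : normedModType R) : R :=
  inf [set r | exists (T : {linear V -> W}) (S : {linear W -> V}),
                 isomorphism T S /\ r = opnorm T * opnorm S].

Definition isometric (R : realType) (V W : normedModType R) : Prop :=
  exists (T : {linear V -> W}) (S : {linear W -> V}),
    [/\ cancel T S, cancel S T & forall x, `|T x| = `|x|].

Definition complemented (R : realType) (lam : R) (W : normedModType R)
    (A : set W) : Prop :=
  exists P : {linear W -> W},
    [/\ continuous P, opnorm P <= lam, forall x, P (P x) = P x & range P = A].

(* "E is contained in W" is rendered by an isometric linear embedding. *)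
Definition injective_space (R : realType) (lam : R)
    (E : completeNormedModType R) : Prop :=
  forall (W : completeNormedModType R) (J : {linear E -> W}),
    (forall x, `|J x| = `|x|) -> complemented lam (range J).

Definition separable (T : topologicalType) : Prop :=
  exists2 D : set T, countable D & dense D.

Definition eps_isometry (R : realType) (X Y : normedModType R) (eps : R)
    (f : X -> Y) : Prop :=
  forall x y, `| `|f x - f y| - `|x - y| | <= eps.

Definition standard (R : realType) (X Y : normedModType R) (f : X -> Y) : Prop :=
  f 0 = 0.

Definition linspan (R : realType) (V : lmodType R) (A : set V) : set V :=
  [set v | exists s : seq (R * V),
     (forall p, p \in s -> A p.2) /\ v = \sum_(p <- s) p.1 *: p.2].

Section ClosedSpan.
Context (R : realType) (V : normedModType R) (A : set V).

Lemma sub_linspan : A `<=` linspan A.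
Proof.
move=> v Av; exists [:: (1, v)]; split => [p|]; last by rewrite big_seq1 scale1r.
by rewrite inE => /eqP ->.
Qed.

Lemma linspan0 : linspan A 0.
Proof. by exists [::]; split => //; rewrite big_nil. Qed.

Lemma linspanL (a : R) u v : linspan A u -> linspan A v -> linspan A (a *: u + v).
Proof.
move=> [s [sA ->]] [t [tA ->]]; exists ([seq (a * p.1, p.2) | p <- s] ++ t).
split=> [p|]; last first.
  rewrite big_cat big_map scaler_sumr; congr (_ + _).
  by apply: eq_bigr => p _; rewrite scalerA.
by rewrite mem_cat => /orP[/mapP[q qs ->]|]; [exact: sA qs|exact: tA].
Qed.

Fact closed_span0 : closure (linspan A) 0.
Proof. exact/subset_closure/linspan0. Qed.

Fact closed_spanL (a : R) u v : closure (linspan A) u -> closure (linspan A) v ->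
  closure (linspan A) (a *: u + v).
Proof.
move=> uA vA B nB.
have : (fun z : V * V => a *: z.1 + z.2) @ (u, v) --> a *: u + v.
  apply: cvgD; last exact: cvg_snd.
  by apply: cvgZl_tmp; exact: cvg_fst.
move=> /(_ _ nB) [[U1 V1] /= [nU nV] UV].
have [x [Ax Ux]] := uA _ nU; have [y [Ay Vy]] := vA _ nV.
exists (a *: x + y); split; first exact: linspanL.
exact: (UV (x, y)).
Qed.

Definition closed_span : closedSubspace V :=
  ClosedSubspace closed_span0 closed_spanL (@closed_closure _ (linspan A)).

End ClosedSpan.

Section Stability.
Context (R : realType) (X Y : normedModType R).

Definition Lspace (f : X -> Y) : closedSubspace Y := closed_span (range f).

Fact Lspace_im (f : X -> Y) (x : X) : f x \in cs_pred (Lspace f).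
Proof. by apply/mem_set/subset_closure/sub_linspan; exists x. Qed.

Definition Lcorestr (f : X -> Y) (x : X) : subspaceType (Lspace f) :=
  SubspaceType (Lspace_im f x).

Definition stable_map (alpha gamma eps : R) (f : X -> Y) : Prop :=
  exists T : {linear subspaceType (Lspace f) -> X},
    [/\ continuous T, opnorm T <= alpha &
        forall x, `|T (Lcorestr f x) - x| <= gamma * eps].

End Stability.

Definition stable_pair (R : realType) (alpha gamma : R)
    (X Y : normedModType R) : Prop :=
  forall eps : R, 0 <= eps -> forall f : X -> Y,
    eps_isometry eps f -> standard f -> stable_map alpha gamma eps f.

(* Main.v *)
Require Import Defs.
From HB Require Import structures.
From mathcomp Require Import all_boot all_order all_algebra.
From mathcomp Require Import all_classical all_reals all_analysis.
From mathcomp Require Import ring lra.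

Set Implicit Arguments.
Unset Strict Implicit.
Unset Printing Implicit Defensive.

Import Order.TTheory GRing.Theory Num.Theory.
Import numFieldNormedType.Exports.

Local Open Scope classical_set_scope.
Local Open Scope ring_scope.

(** Suppose first that X is c_0.  Each coordinate functional xi of norm at
    most 1 on X is transported to Y by a functional phi of norm at most 1 for
    which c <= phi (f x) - xi x <= c + 3 eps for some c and all x
    ([weak_stability]).  The family of these phi need not send Y into c_0, and
    this is repaired as in the proof of Sobczyk's theorem: the coordinates of
    a fixed x tend to 0, so any limit psi of the phi along a free ultrafilter
    satisfies l <= psi (f x) <= l + 3 eps, with l the limit of the c's.
    Subtracting psi costs a factor 2 in the norm.  The error of phi - psi is a
    difference of two points of intervals of the same length 3 eps whose left
    ends are as close as desired, so it is at most 4 eps; estimating both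
    errors separately would give 6 eps.  As Y is separable,
    countably many closeness conditions suffice, and any finite number of them
    is met outside finitely many coordinates ([approximating_family]).

    Weak stability follows, by a Hahn-Banach sandwich theorem ([sandwich]),
    from an inequality between norms of finite positive combinations of
    differences ([norm_positive_combination]).  That inequality holds
    because, far away in a prescribed direction, there is a point v at which
    the norm is almost differentiable in finitely many given directions
    ([diff2_small_near]); a functional norming f v - f (- v) is then
    pinned down on the images of finitely many given points, up to 3 eps, by
    the triangle inequalities through f v and f (- v).

    The three cases differ by bookkeeping.  In the l_infinity-sum of the
    c_0(Gamma_i) the subtraction is done inside each block.  In a c_0-sum of
    spaces E_i that are retracts of l_infinity(J_i), a level i carries all
    functionals indexed by J_i, the correction vanishes uniformly on each level
    as i goes to infinity, and the retraction brings the result back to E_i,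
    multiplying all bounds by its norm.  A lambda-injective space is such a
    retract, with norm lambda, of the bounded functions on its dual ball. *)

(** * Linear maps and functionals from their graphs *)

Lemma linear_pack {R : realType} {V W : lmodType R} (B : V -> W) :
  linear B -> exists T : {linear V -> W}, forall x, T x = B x.
Proof.
move=> Blin.
pose T : {linear V -> W} := HB.pack B (GRing.isLinear.Build _ _ _ _ _ Blin).
by exists T.
Qed.

Lemma scalar_pack {R : realType} {V : lmodType R} (B : V -> R) :
  scalar B -> exists T : {scalar V}, forall x, T x = B x.
Proof.
move=> Blin.
pose T : {scalar V} := HB.pack B (GRing.isLinear.Build _ _ _ _ _ Blin).
by exists T.
Qed.

(** * A sandwich form of the Hahn-Banach theorem *)

Definition sublinear {R : realType} {V : lmodType R} (q : V -> R) : Prop :=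
  (forall x y, q (x + y) <= q x + q y) /\
  (forall (t : R) x, 0 <= t -> q (t *: x) <= t * q x).

(** The second component of a point of the cone is a lower bound demanded of
    the value at the first component of the functional to be constructed. *)
Definition convex_cone {R : realType} {V : lmodType R} (C : set (V * R)) : Prop :=
  [/\ C (0, 0),
      forall c d, C c -> C d -> C (c.1 + d.1, c.2 + d.2) &
      forall (t : R) c, 0 <= t -> C c -> C (t *: c.1, t * c.2)].

Definition ray {R : realType} {V : lmodType R} (x : V) (a : R) : set (V * R) :=
  [set c | exists2 t : R, 0 <= t & c = (t *: x, t * a)].

Lemma convex_cone_ray {R : realType} {V : lmodType R} (x : V) (a : R) :
  convex_cone (ray x a).
Proof.
split; first by exists 0; rewrite ?scale0r ?mul0r.
  move=> _ _ [s s0 ->] [t t0 ->]; exists (s + t); first exact: addr_ge0.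
  by rewrite scalerDl mulrDl.
move=> s _ s0 [t t0 ->]; exists (s * t); first exact: mulr_ge0.
by rewrite scalerA mulrA.
Qed.

Lemma ray1 {R : realType} {V : lmodType R} (x : V) (a : R) : ray x a (x, a).
Proof. by exists 1; rewrite ?scale1r ?mul1r. Qed.

(** When c.2 <= q c.1 on C, this is the largest sublinear p below q such that
    p (- c.1) <= - c.2 on C; for a linear p the last condition reads
    c.2 <= p c.1. *)
Definition cone_shift {R : realType} {V : lmodType R} (q : V -> R)
    (C : set (V * R)) (y : V) : R :=
  inf [set q (y + c.1) - c.2 | c in C].

Lemma sublinear0 {R : realType} {V : lmodType R} (q : V -> R) :
  sublinear q -> q 0 = 0.
Proof.
move=> [qD qZ]; apply/eqP; rewrite eq_le; apply/andP; split.
  by have := qZ 0 0 (lexx _); rewrite scale0r mul0r.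
by have := qD 0 0; rewrite addr0; lra.
Qed.

Lemma sublinearN {R : realType} {V : lmodType R} (q : V -> R) y :
  sublinear q -> - q (- y) <= q y.
Proof.
move=> sq; have := sublinear0 sq; case: sq => qD _.
by have := qD y (- y); rewrite subrr; lra.
Qed.

Section ConeShift.
Context {R : realType} {V : lmodType R} (q : V -> R) (C : set (V * R)).
Context (sq : sublinear q) (coneC : convex_cone C).
Context (qC : forall c, C c -> c.2 <= q c.1).

Let shift_lb y : lbound [set q (y + c.1) - c.2 | c in C] (- q (- y)).
Proof.
move=> _ [c Cc <-]; have := qC Cc; case: sq => qD _.
by have := qD (y + c.1) (- y); rewrite addrAC subrr add0r; lra.
Qed.

Let shift_nonempty y : [set q (y + c.1) - c.2 | c in C] !=set0.
Proof. by case: coneC => C0 _ _; exists (q (y + 0) - 0), (0, 0). Qed.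

Lemma cone_shift_le y c : C c -> cone_shift q C y <= q (y + c.1) - c.2.
Proof. by move=> Cc; apply: ge_inf; [exists (- q (- y)) | exists c]. Qed.

Lemma le_cone_shift y a :
  (forall c, C c -> a <= q (y + c.1) - c.2) -> a <= cone_shift q C y.
Proof. by move=> ha; apply: lb_le_inf => // _ [c Cc <-]; exact: ha. Qed.

Lemma cone_shift_dominated y : cone_shift q C y <= q y.
Proof.
by case: coneC => C0 _ _; have := cone_shift_le y C0; rewrite /= addr0 subr0.
Qed.

Lemma cone_shiftN c : C c -> cone_shift q C (- c.1) <= - c.2.
Proof.
by move=> Cc; have := cone_shift_le (- c.1) Cc; rewrite addNr (sublinear0 sq) sub0r.
Qed.

Lemma cone_shift_sublinear : sublinear (cone_shift q C).
Proof.
case: (sq) => qD qZ; case: (coneC) => C0 CD CZ; split => [x y|t x t0].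
  suff h c d : C c -> C d -> cone_shift q C (x + y) <=
      (q (x + c.1) - c.2) + (q (y + d.1) - d.2).
    rewrite -lerBlDr; apply: le_cone_shift => c Cc.
    rewrite lerBlDr -lerBlDl; apply: le_cone_shift => d Cd.
    by rewrite lerBlDl h.
  move=> Cc Cd; apply: le_trans (cone_shift_le _ (CD _ _ Cc Cd)) _ => /=.
  by rewrite addrACA; have := qD (x + c.1) (y + d.1); lra.
have [->|tn0] := eqVneq t 0.
  by rewrite scale0r mul0r -(sublinear0 sq) cone_shift_dominated.
have {}t0 : 0 < t by rewrite lt_def tn0.
rewrite -ler_pdivrMl//; apply: le_cone_shift => c Cc.
rewrite ler_pdivrMl//.
apply: le_trans (cone_shift_le _ (CZ t c (ltW t0) Cc)) _ => /=.
by rewrite -scalerDr mulrBr lerD2r qZ// ltW.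
Qed.

End ConeShift.

(** The pointwise infimum of a chain of sublinear functionals is sublinear,
    being bounded below by [- p (- x)], so Zorn's lemma applies. *)
Lemma minimal_sublinear {R : realType} {V : lmodType R} (p : V -> R) :
  sublinear p -> exists q : V -> R,
    [/\ sublinear q, forall x, q x <= p x &
        forall q', sublinear q' -> (forall x, q' x <= q x) -> q' = q].
Proof.
move=> sp.
pose T := {q : V -> R | sublinear q /\ forall x, q x <= p x}.
pose le (s t : T) : bool := `[< forall x, sval t x <= sval s x >].
have [||| A totA|[q [sq qp]] qmax] := @Zorn T le.
- by move=> t; apply/asboolP.
- move=> r s t /asboolP rs /asboolP st; apply/asboolP => x.
  exact: le_trans (st x) (rs x).
- move=> [s s1] [t t1] /asboolP /= ts /asboolP /= st.
  apply: eq_exist; apply/funext => x; apply/eqP; rewrite eq_le.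
  by rewrite st ts.
- have [[q0 Aq0]|A0] := pselect (A !=set0); last first.
    exists (exist _ p (conj sp (fun x => lexx (p x)))) => s As.
    by case: A0; exists s.
  pose m x := inf [set sval t x | t in A].
  have mlb x : lbound [set sval t x | t in A] (- p (- x)).
    move=> _ [[t [st tp]] At <-] /=; apply: le_trans (sublinearN x st).
    by rewrite lerN2.
  have mle x t : A t -> m x <= sval t x.
    by move=> At; apply: ge_inf; [exists (- p (- x)) | exists t].
  have le_m x a : (forall t, A t -> a <= sval t x) -> a <= m x.
    by move=> h; apply: lb_le_inf; [exists (sval q0 x), q0 | move=> _ [t At <-]; exact: h].
  have sm : sublinear m.
    split => [x y|t x t0].
      suff h s t : A s -> A t -> m (x + y) <= sval s x + sval t y.
        rewrite -lerBlDr; apply: (le_m x) => s As.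
        by rewrite lerBlDr -lerBlDl; apply: (le_m y) => t At; rewrite lerBlDl h.
      move=> As At; have [/asboolP st|/asboolP ts] := totA _ _ As At.
        apply: le_trans (mle _ _ At) _.
        by apply: le_trans ((svalP t).1.1 x y) _; rewrite lerD2r.
      apply: le_trans (mle _ _ As) _.
      by apply: le_trans ((svalP s).1.1 x y) _; rewrite lerD2l.
    have [->|tn0] := eqVneq t 0.
      rewrite scale0r mul0r; apply: le_trans (mle _ _ Aq0) _.
      by rewrite (sublinear0 (svalP q0).1).
    have {}t0 : 0 < t by rewrite lt_def tn0.
    rewrite -ler_pdivrMl//; apply: (le_m x) => s As; rewrite ler_pdivrMl//.
    exact: le_trans (mle _ _ As) ((svalP s).1.2 _ _ (ltW t0)).
  have mp x : m x <= p x := le_trans (mle x _ Aq0) ((svalP q0).2 x).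
  by exists (exist _ m (conj sm mp)) => s As; apply/asboolP => x; exact: mle.
- exists q; split => // q' sq' q'q.
  have q'p x : q' x <= p x by exact: le_trans (q'q x) (qp x).
  have h := qmax (exist _ q' (conj sq' q'p)).
  by have /(congr1 sval) := h (asboolT q'q).
Qed.

(** If q is minimal, then lowering q along the ray through (x, q x) changes
    nothing, which forces q (- x) <= - q x; a sublinear functional that is odd
    is linear. *)
Lemma minimal_sublinear_linear {R : realType} {V : lmodType R} (q : V -> R) :
  sublinear q ->
  (forall q', sublinear q' -> (forall x, q' x <= q x) -> q' = q) ->
  exists phi : {scalar V}, forall x, phi x = q x.
Proof.
move=> sq qmin; case: (sq) => qD qZ.
have qZp (t : R) x : 0 <= t -> q (t *: x) = t * q x.
  move=> t0; apply/eqP; rewrite eq_le qZ//=.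
  have [->|tn0] := eqVneq t 0; first by rewrite mul0r scale0r sublinear0.
  have {}t0 : 0 < t by rewrite lt_def tn0.
  rewrite -ler_pdivlMl// -[in leLHS](scalerK tn0 x).
  by apply: qZ; rewrite invr_ge0 ltW.
have qN x : q (- x) = - q x.
  apply/eqP; rewrite eq_le; apply/andP; split; last first.
    by rewrite lerNl -[leRHS]/(q x) sublinearN.
  have qC c : ray x (q x) c -> c.2 <= q c.1 by case=> t t0 -> /=; rewrite qZp.
  have qE := qmin _ (cone_shift_sublinear sq (convex_cone_ray x (q x)) qC)
                     (cone_shift_dominated sq (convex_cone_ray x (q x)) qC).
  by have := cone_shiftN sq qC (ray1 x (q x)); rewrite qE.
have qlin : scalar q.
  move=> a x y; apply/eqP; rewrite eq_le.
  have qZa (b : R) z : q (b *: z) = b * q z.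
    have [b0|/ltW b0] := leP 0 b; first exact: qZp.
    by rewrite -[b]opprK scaleNr qN qZp ?oppr_ge0// -mulNr.
  have h1 := qD (a *: x) y; have h2 := qD (a *: x + y) (- y).
  rewrite addrK qN !qZa in h1 h2.
  apply/andP; split; first exact: h1.
  by rewrite -lerBrDr.
exact: scalar_pack.
Qed.

(** A form of the Mazur-Orlicz theorem: lower q until it incorporates the
    demands of C, then take a minimal sublinear functional below the result. *)
Lemma sandwich {R : realType} {V : lmodType R} (q : V -> R) (C : set (V * R)) :
  sublinear q -> convex_cone C -> (forall c, C c -> c.2 <= q c.1) ->
  exists phi : {scalar V},
    (forall x, phi x <= q x) /\ (forall c, C c -> c.2 <= phi c.1).
Proof.
move=> sq coneC qC.
have [p [sp pq pmin]] := minimal_sublinear (cone_shift_sublinear sq coneC qC).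
have [phi phip] := minimal_sublinear_linear sp pmin.
exists phi; split => [x|c Cc].
  rewrite phip; exact: le_trans (pq x) (cone_shift_dominated sq coneC qC x).
rewrite -lerN2 -[leLHS]linearN phip.
exact: le_trans (pq _) (cone_shiftN sq qC Cc).
Qed.

Lemma norming_functional {R : realType} {V : normedModType R} (v : V) :
  exists phi : {scalar V},
    (forall x, `|phi x| <= `|x|) /\ phi v = `|v|.
Proof.
have sq : sublinear (fun x : V => `|x|).
  split; first exact: ler_normD.
  by move=> t x t0; rewrite normrZ ger0_norm.
have [|phi [phile phiC]] := sandwich sq (convex_cone_ray v `|v|).
  by move=> _ [t t0 ->] /=; rewrite normrZ ger0_norm.
exists phi; split => [x|].
  rewrite -[phi x]/(phi x : R) ler_norml phile andbT lerNl -[- _]linearN.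
  by rewrite -normrN; exact: phile.
apply/eqP; rewrite eq_le; apply/andP; split.
  exact: phile.
exact: (phiC (v, `|v|) (ray1 _ _)).
Qed.

(** * Points where the norm is almost flat to second order *)

Definition diff2 {R : realType} {V : normedModType R} (v x : V) : R :=
  `|v + x| + `|v - x| - 2 * `|v|.

Lemma diff2_ge0 {R : realType} {V : normedModType R} (v x : V) : 0 <= diff2 v x.
Proof.
have := ler_normD (v + x) (v - x).
rewrite addrACA subrr addr0 -mulr2n normrMn /diff2 -mulr_natl; lra.
Qed.

(** The second differences along a line telescope to a difference of two slopes
    of a 1-Lipschitz function, a bound that does not grow with n. *)
Lemma sum_diff2_line {R : realType} {V : normedModType R} (v x : V) n :
  \sum_(0 <= k < n) diff2 (v + x *+ k) x <= 2 * `|x|.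
Proof.
have -> : \sum_(0 <= k < n) diff2 (v + x *+ k) x =
    (`|v + x *+ n| - `|v + x *+ n - x|) - (`|v| - `|v - x|).
  elim: n => [|n IHn]; first by rewrite big_nil mulr0n addr0; ring.
  rewrite big_nat_recr//= IHn /diff2 [x *+ n.+1]mulrSr; set a := x *+ n.
  rewrite (addrA v a x); rewrite addrK; ring.
have h1 : `|v + x *+ n| - `|v + x *+ n - x| <= `|x|.
  by rewrite lerBlDl -{1}(subrK x (v + x *+ n)) ler_normD.
have h2 : `|v - x| - `|v| <= `|x| by rewrite lerBlDl -(normrN x) ler_normD.
lra.
Qed.

(** Averaging over a long arithmetic progression of step x makes the mean
    second difference in direction x small, and keeps a bound already
    obtained, for all base points, in other directions.  Hence the induction,
    with translates that do not depend on v. *)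
Lemma mean_diff2_le {R : realType} {V : normedModType R} (xs : seq V) (d : R) :
  0 < d -> exists ts : seq V, (0 < size ts)%N /\ forall v x, x \in xs ->
    \sum_(t <- ts) diff2 (v + t) x <= d * (size ts)%:R.
Proof.
move=> d0; elim: xs => [|x xs [ts [ts0 IH]]]; first by exists [:: 0].
have [K KP] : exists K, 2 * `|x| <= d * K.+1%:R.
  exists (Num.bound (2 * `|x| / d)).
  rewrite -ler_pdivrMl// mulrC; apply: ltW; apply: lt_trans (archi_boundP _) _.
    by rewrite divr_ge0 ?mulr_ge0// ltW.
  by rewrite ltr_nat.
exists [seq t + x *+ k | t <- ts, k <- index_iota 0 K.+1].
have sz : size [seq t + x *+ k | t <- ts, k <- index_iota 0 K.+1] =
    (size ts * K.+1)%N by rewrite size_allpairs size_iota subn0.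
rewrite sz; split; first by rewrite muln_gt0 ts0.
move=> v y; rewrite inE => /orP[/eqP->|yxs]; rewrite big_allpairs_dep /=.
  have -> : d * (size ts * K.+1)%:R = \sum_(t <- ts) (d * K.+1%:R).
    by rewrite big_const_seq iter_addr_0 count_predT natrM -mulr_natr; ring.
  apply: ler_sum => t _; apply: le_trans KP.
  by under eq_bigr do rewrite addrA; exact: sum_diff2_line.
rewrite exchange_big /=.
have -> : d * (size ts * K.+1)%:R = \sum_(0 <= k < K.+1) (d * (size ts)%:R).
  by rewrite big_const_nat iter_addr_0 subn0 natrM -mulr_natr; ring.
apply: ler_sum => k _.
by under eq_bigr do rewrite addrA addrAC; exact: IH.
Qed.

(** A quantitative, finite form of the density of smooth points of the norm.
    The bound C does not depend on v, so the correction t becomes negligible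
    when v is a large multiple of a fixed vector. *)
Lemma diff2_small_near {R : realType} {V : normedModType R} (xs : seq V) (d : R) :
  0 < d -> exists C : R, forall v, exists t,
    `|t| <= C /\ forall x, x \in xs -> diff2 (v + t) x <= d.
Proof.
move=> d0; (* A mean below e in each of the size xs directions leaves a translate where
   all of these second differences add up to less than d. *)
pose e := d / (size xs).+1%:R.
have e0 : 0 < e by rewrite divr_gt0.
have [ts [ts0 tsP]] := mean_diff2_le xs e0.
exists (\sum_(t <- ts) `|t|) => v; apply: contrapT => nt.
have tC t : t \in ts -> `|t| <= \sum_(t <- ts) `|t|.
  by move=> tts; rewrite (big_rem t)//= lerDl sumr_ge0.
have big t : t \in ts -> d <= \sum_(x <- xs) diff2 (v + t) x.
  move=> tts; apply: contrapT => /negP; rewrite -ltNge => lt_d.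
  apply: nt; exists t; split; first exact: tC.
  move=> x xxs; apply: le_trans (ltW lt_d); rewrite (big_rem x)//= lerDl.
  by apply: sumr_ge0 => *; exact: diff2_ge0.
have : \sum_(t <- ts) d <= \sum_(x <- xs) (e * (size ts)%:R).
  rewrite (@le_trans _ _ (\sum_(t <- ts) \sum_(x <- xs) diff2 (v + t) x))//.
    by rewrite !big_seq; apply: ler_sum => t; exact: big.
  rewrite exchange_big [leLHS]big_seq [leRHS]big_seq /=; apply: ler_sum => x; exact: tsP.
rewrite !big_const_seq !iter_addr_0 !count_predT -[d *+ _]mulr_natr -[_ * _ *+ _]mulr_natr.
rewrite mulrAC ler_pM2r ?ltr0n// /e mulrAC ler_pdivlMr// ler_pM2l// ler_nat.
by rewrite ltnn.
Qed.

(** * Weak stability of functionals *)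

(** The value of phi at f v - f (- v) is at least 2|v| - eps, so the two
    triangle inequalities bounding phi (f v) - phi (f x) and
    phi (f x') - phi (f (- v)) from above become a lower bound for
    phi (f x - f x').  Each of the three estimates loses eps once, and d
    bounds the distance from xi x to |v| - |v - x| and to |v + x| - |v|. *)
Lemma norming_pair {R : realType} {X Y : normedModType R} {eps : R} {f : X -> Y}
    (v x x' : X) (xi : {scalar X}) (phi : {scalar Y}) (d : R) :
  eps_isometry eps f ->
  (forall z, `|xi z| <= `|z|) -> xi v = `|v| ->
  (forall y, `|phi y| <= `|y|) -> phi (f v - f (- v)) = `|f v - f (- v)| ->
  diff2 v x <= d -> diff2 v x' <= d ->
  xi (x - x') - (3 * eps + 2 * d) <= phi (f x - f x').
Proof.
move=> fe xile xiv phile phiv dx dx'.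
have up a b : phi (f a) - phi (f b) <= `|a - b| + eps.
  rewrite -linearB; apply: le_trans (ler_norm _) _.
  apply: le_trans (phile _) _; have := fe a b; rewrite ler_norml; lra.
have xile' z : xi z <= `|z| := le_trans (ler_norm _) (xile z).
have vv : 2 * `|v| - eps <= phi (f v) - phi (f (- v)).
  rewrite -linearB phiv.
  have := fe v (- v); rewrite opprK -mulr2n normrMn -mulr_natl ler_norml; lra.
have h1 := up v x; have h2 := up x' (- v).
have h3 := xile' (v + x); have h4 := xile' (v - x').
rewrite linearD xiv in h3; rewrite linearB xiv in h4.
rewrite opprK in h2; rewrite (addrC x') in h2.
rewrite !linearB; move: dx dx'; rewrite /diff2; lra.
Qed.

(** Test both combinations against the functionals of [norming_pair] at a point
    v close to a large multiple of the left-hand vector: xi almost norms that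
    vector, and the pairwise estimates add up because the weights are
    nonnegative. *)
Lemma norm_positive_combination {R : realType} {X Y : normedModType R} {eps : R}
    {f : X -> Y} (l : seq (R * (X * X))) :
  eps_isometry eps f -> (forall p, p \in l -> 0 <= p.1) ->
  `|\sum_(p <- l) p.1 *: (p.2.1 - p.2.2)| <=
  `|\sum_(p <- l) p.1 *: (f p.2.1 - f p.2.2)| + 3 * eps * \sum_(p <- l) p.1.
Proof.
move=> fe l0; set w := \sum_(p <- l) _ *: _; set u := \sum_(p <- l) _ *: (f _ - _).
set s := \sum_(p <- l) p.1.
have s0 : 0 <= s by rewrite /s big_seq sumr_ge0.
suff claim (d : R) : 0 < d -> `|w| <= `|u| + (3 * eps + 2 * d) * s.
  apply/ler_addgt0Pr => e e0; pose d := e / (2 * (s + 1)).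
  have s1 : 0 < 2 * (s + 1) by lra.
  have d0 : 0 < d by rewrite divr_gt0.
  have de : d * (2 * (s + 1)) = e by rewrite /d divfK// gt_eqF.
  by move: (claim d d0) (d0) de; clearbody d; nra.
move=> d0; rewrite leNgt; apply/negP => lt_w.
pose xs := [seq p.2.1 | p <- l] ++ [seq p.2.2 | p <- l].
have [C CP] := diff2_small_near xs d0.
set B := _ + _ * s in lt_w.
(* This M makes M (|w| - B) exceed 2|C|, the total cost of replacing M w by v. *)
pose M := (2 * `|C| + 1) / (`|w| - B).
have Bw : 0 < `|w| - B by rewrite subr_gt0.
have MB : M * (`|w| - B) = 2 * `|C| + 1 by rewrite /M divfK// gt_eqF.
have M0 : 0 < M by rewrite divr_gt0//; have := normr_ge0 C; lra.
have [t [tC tP]] := CP (M *: w); set v := M *: w + t in tP.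
have [xi [xile xiv]] := norming_functional v.
have [phi [phile phiv]] := norming_functional (f v - f (- v)).
have pair p : p \in l ->
    p.1 * (xi (p.2.1 - p.2.2) - (3 * eps + 2 * d)) <= p.1 * phi (f p.2.1 - f p.2.2).
  move=> pl; apply: ler_wpM2l; first exact: l0.
  apply: (norming_pair fe xile xiv phile phiv); apply: tP; rewrite mem_cat.
    by rewrite (map_f (fun p => p.2.1) pl).
  by rewrite (map_f (fun p => p.2.2) pl) orbT.
have h1 : xi w - (3 * eps + 2 * d) * s <= phi u.
  rewrite /w /u !linear_sum /= [X in _ - X]mulr_sumr -sumrB.
  rewrite [leLHS]big_seq [leRHS]big_seq; apply: ler_sum => p pl.
  by have := pair p pl; rewrite [xi (_ *: _)]linearZ [phi (_ *: _)]linearZ /=; lra.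
have h2 : phi u <= `|u| := le_trans (ler_norm _) (phile u).
have h3 : `|v| - `|t| <= M * xi w.
  have := le_trans (ler_norm _) (xile t); move: xiv.
  by rewrite {1}/v linearD linearZ /=; lra.
have h4 : M * `|w| - `|t| <= `|v|.
  have := ler_normB v t; rewrite {1}/v addrK normrZ gtr0_norm//; lra.
have h5 : M * xi w <= M * B by rewrite ler_pM2l// /B; lra.
have := ler_norm C; rewrite mulrBr in MB; lra.
Qed.

(** The demands phi (f x) - phi (f x') >= xi x - xi x' - 3 r eps for all pairs
    generate a cone, and [norm_positive_combination] is the compatibility
    condition that the sandwich theorem needs.  Demands on differences bound the
    oscillation of phi (f x) - xi x, not only its size; the later
    comparison of two such functionals relies on this. *)
Lemma weak_stability {R : realType} {X Y : normedModType R} {eps : R}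
    {f : X -> Y} (r : R) (xi : {scalar X}) :
  eps_isometry eps f -> 0 <= r -> (forall x, xi x <= r * `|x|) ->
  exists phi : {scalar Y}, (forall y, `|phi y| <= r * `|y|) /\
    exists c, forall x, c <= phi (f x) - xi x <= c + 3 * r * eps.
Proof.
move=> fe r0 xile.
pose pt (p : R * (X * X)) : Y * R :=
  (p.1 *: (f p.2.1 - f p.2.2), p.1 * (xi (p.2.1 - p.2.2) - 3 * r * eps)).
pose C : set (Y * R) := [set c | exists2 l : seq (R * (X * X)),
  (forall p, p \in l -> 0 <= p.1) &
  c = (\sum_(p <- l) (pt p).1, \sum_(p <- l) (pt p).2)].
have coneC : convex_cone C.
  split; first by exists [::] => //; rewrite !big_nil.
    move=> _ _ [l l0 ->] [l' l'0 ->]; exists (l ++ l'); last by rewrite !big_cat.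
    by move=> p; rewrite mem_cat => /orP[/l0|/l'0].
  move=> t _ t0 [l l0 ->]; exists [seq (t * p.1, p.2) | p <- l].
    by move=> _ /mapP[p pl ->] /=; rewrite mulr_ge0// l0.
  rewrite !big_map /= scaler_sumr mulr_sumr.
  congr pair; apply: eq_bigr => p _ /=; first by rewrite scalerA.
  by rewrite mulrA.
have sq : sublinear (fun y : Y => r * `|y|).
  split=> [x y|t x t0]; first by rewrite -mulrDr ler_wpM2l// ler_normD.
  by rewrite normrZ ger0_norm// mulrCA.
have [|phi [phile phiC]] := sandwich sq coneC.
  move=> _ [l l0 ->] /=.
  have := ler_wpM2l r0 (norm_positive_combination fe l0).
  set w := \sum_(p <- l) _ *: _; set u := \sum_(p <- l) _ *: (f _ - _).
  have := xile w; rewrite /w linear_sum /=.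
  suff -> : \sum_(p <- l) xi (p.1 *: (p.2.1 - p.2.2)) =
    \sum_(p <- l) (pt p).2 + r * (3 * eps * \sum_(p <- l) p.1) by rewrite mulrDr; lra.
  rewrite !mulr_sumr -big_split /=; apply: eq_bigr => p _; rewrite linearZ /=; ring.
exists phi; split => [y|].
  rewrite ler_norml phile andbT lerNl -linearN.
  by apply: le_trans (phile _) _; rewrite normrN.
have phif x x' : xi x - xi x' - 3 * r * eps <= phi (f x) - phi (f x').
  rewrite -!linearB.
  have := phiC (pt (1, (x, x'))); rewrite /pt/= scale1r mul1r; apply.
  exists [:: (1, (x, x'))]; first by move=> p; rewrite inE => /eqP ->.
  by rewrite !big_seq1 /pt/= scale1r mul1r.
pose G := range (fun x => phi (f x) - xi x).
have lbG x : lbound G (phi (f x) - xi x - 3 * r * eps).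
  by move=> _ [x' _ <-]; have := phif x' x; lra.
exists (inf G) => x; apply/andP; split.
  by apply: ge_inf; [exists (phi (f x) - xi x - 3 * r * eps) | exists x].
by rewrite -lerBlDr; apply: lb_le_inf => //; exists (phi (f x) - xi x), x.
Qed.

(** * Functionals vanishing at infinity *)

(** A cluster point of the image of an ultrafilter is its limit. *)
Lemma ultra_bounded_cvg {R : realType} {T : Type} (U : set_system T)
    (h : T -> R) (M : R) :
  UltraFilter U -> (forall t, `|h t| <= M) -> exists l : R, h @ U --> l.
Proof.
move=> UU hM.
have hI : (h @ U) `[- M, M]%classic.
  by apply: nearW => t; rewrite /= in_itv /= -ler_norml.
have [l [_ lcl]] := segment_compact (F := h @ U) _ hI.
exists l => A /= nA; have [//|UnA] := in_ultra_setVsetC (h @^-1` A) UU.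
by have [x [+ Ax]] := lcl (~` A) A UnA nA.
Qed.

Lemma free_ultrafilter (T : Type) : infinite_set [set: T] ->
  exists U : set_system T, UltraFilter U /\ forall A, finite_set A -> U (~` A).
Proof.
move=> infT; pose F : set_system T := [set A | finite_set (~` A)].
have FF : ProperFilter F.
  apply: Build_ProperFilter; first by rewrite /F /= setC0.
  split; first exact: cofinite_setT.
    by move=> A B FA FB; rewrite /F /= cofinite_setI.
  by move=> A B; exact: sub_cofinite_set.
have [U [UU FU]] := ultraFilterLemma FF.
by exists U; split=> // A Afin; apply: FU; rewrite /F /= setCK.
Qed.

(** Pointwise ultralimits replace the weak-star compactness of dual balls. *)
Lemma ultra_limit_functional {R : realType} {Y : normedModType R} {T : Type}
    (U : set_system T) (phi : T -> {scalar Y}) (r : R) :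
  UltraFilter U -> (forall t y, `|phi t y| <= r * `|y|) ->
  exists psi : {scalar Y}, (forall y, `|psi y| <= r * `|y|) /\
    forall y, phi t y @[t --> U] --> psi y.
Proof.
move=> UU phile.
have lim y : exists l : R, phi t y @[t --> U] --> l.
  exact: (ultra_bounded_cvg UU (fun t => phile t y)).
have [p pP] := choice lim.
have plin : scalar p.
  move=> a x y; apply: (@cvg_unique R _ (phi t (a *: x + y) @[t --> U])) => //.
    exact: pP.
  rewrite /=; have -> : (fun t => phi t (a *: x + y)) = (fun t => a * phi t x + phi t y).
    by apply/funext => t; rewrite linearP.
  by apply: cvgD (pP y); apply: cvgMr; exact: pP.
have [psi psiE] := scalar_pack plin; exists psi; split => y; rewrite psiE //.
by apply: cvgr_to_le (cvg_norm (pP y)) _; exact: nearW.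
Qed.

Section Vanishing.
Context {R : realType} {X Y : normedModType R} (eps r : R) (f : X -> Y).
Context (eps0 : 0 <= eps) (r0 : 0 <= r).
Context (fe : eps_isometry eps f) (f0 : standard f).

Definition approximates (xi : {scalar X}) (tau : {scalar Y}) : Prop :=
  (forall y, `|tau y| <= 2 * r * `|y|) /\
  (forall x, `|tau (f x) - xi x| <= 4 * r * eps).

Lemma exists_approximates (xi : {scalar X}) :
  (forall x, `|xi x| <= r * `|x|) -> exists tau, approximates xi tau.
Proof.
move=> xile.
have [phi [phile [c cP]]] := weak_stability fe r0 (fun x => le_trans (ler_norm _) (xile x)).
have re0 : 0 <= r * eps by exact: mulr_ge0.
have := cP 0; rewrite f0 !linear0 => c0.
exists phi; split => [y|x].
  by apply: le_trans (phile y) _; have := mulr_ge0 r0 (normr_ge0 y); lra.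
by have := cP x; rewrite ler_norml; lra.
Qed.

(** The transported functionals phi t converge to some psi with
    l <= psi (f x) <= l + 3 r eps, where l is the limit of the c t, and tau t = phi t - psi.  Once c t is within
    r eps of l, the intervals containing phi t (f x) - xi t x and psi (f x) lie
    close enough for an error of 4 r eps. *)
Lemma near_approximates {T : Type} (U : set_system T) (xi : T -> {scalar X}) :
  UltraFilter U -> (forall t x, `|xi t x| <= r * `|x|) ->
  (forall x, xi t x @[t --> U] --> (0 : R)) ->
  exists tau : T -> {scalar Y}, (forall y, tau t y @[t --> U] --> (0 : R)) /\
    \forall t \near U, approximates (xi t) (tau t).
Proof.
move=> UU xile xi0; have re0 : 0 <= r * eps by exact: mulr_ge0.
have ws t := weak_stability fe r0 (fun x => le_trans (ler_norm _) (xile t x)).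
have [phi phiP] := choice ws.
have phile t := (phiP t).1.
have [c cP] := choice (fun t => (phiP t).2).
have c0 t : - (3 * r * eps) <= c t <= 0.
  by have := cP t 0; rewrite f0 !linear0; lra.
have [l lP] : exists l : R, c @ U --> l.
  apply: (@ultra_bounded_cvg _ _ _ _ (3 * r * eps)) => t.
  by rewrite ler_norml; have := c0 t; lra.
have [psi [psile psiP]] := ultra_limit_functional UU phile.
have psif x : l <= psi (f x) <= l + 3 * r * eps.
  have h : (fun t => phi t (f x) - xi t x - c t) @ U --> psi (f x) - 0 - l.
    by apply: cvgB lP; apply: cvgB (xi0 x); exact: psiP.
  apply/andP; split.
    suff : 0 <= psi (f x) - 0 - l by lra.
    by apply: cvgr_to_ge h _; apply: nearW => t; have := cP t x; lra.
  suff : psi (f x) - 0 - l <= 3 * r * eps by lra.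
  by apply: cvgr_to_le h _; apply: nearW => t; have := cP t x; lra.
have cl : \forall t \near U, `|l - c t| <= r * eps.
  (* Convergence of c gives no bound by 0, but if r eps = 0 the intervals are
     points, and f 0 = 0 puts both at 0. *)
  have [re|re] := eqVneq (r * eps) 0.
    apply: nearW => t; rewrite re.
    by have := psif 0; have := c0 t; rewrite f0 linear0 ler_norml; nra.
  have {}re : 0 < r * eps by rewrite lt_def re.
  by move/cvgrPdist_le : lP; exact.
pose tau t : {scalar Y} := phi t \- psi.
exists tau; split => [y|].
  by rewrite -(subrr (psi y)); apply: cvgB (psiP y) _; exact: cvg_cst.
apply: filterS cl => t ct; split => [y|x].
  rewrite /tau /=; apply: le_trans (ler_normB _ _) _.
  by have := phile t y; have := psile y; lra.
rewrite /tau /=; have := cP t x; have := psif x; move: ct.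
by rewrite !ler_norml; lra.
Qed.

(** Functionals are indexed by K and grouped in levels by lev; vanishing is
    along the levels, uniformly on each of them, since a level may be
    infinite. *)
Context {I K : Type} (lev : K -> I).

Definition level_vanishing {V : normedModType R} (xi : K -> {scalar V}) : Prop :=
  forall x (e : R), 0 < e -> finite_set (lev @` [set k | e <= `|xi k x|]).

(** If infinitely many levels contained a functional without an approximation in
    Q, then a free ultrafilter on those levels would make the chosen
    functionals tend to 0, and [near_approximates] would provide one. *)
Lemma finite_levels_not_approximated (xi : K -> {scalar X})
    (Q : {scalar Y} -> Prop) :
  (forall k x, `|xi k x| <= r * `|x|) -> level_vanishing xi ->
  (forall (T : Type) (U : set_system T) (tau : T -> {scalar Y}),
     UltraFilter U -> (forall y, tau t y @[t --> U] --> (0 : R)) ->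
     \forall t \near U, Q (tau t)) ->
  finite_set (lev @` [set k | ~ exists tau, approximates (xi k) tau /\ Q tau]).
Proof.
move=> xile xiv QU; set B := lev @` _.
have [//|infB] := pselect (finite_set B).
pose T := {i | B i}.
have kP (t : T) : exists k, (~ exists tau, approximates (xi k) tau /\ Q tau) /\
    lev k = sval t by case: t => i [k nk ek]; exists k.
have [k kE] := choice kP.
have infT : infinite_set [set: T].
  move=> finT; apply: infB; rewrite (_ : B = sval @` [set: T]).
    exact: finite_image.
  apply/seteqP; split => [i Bi|_ [[i Bi] _ <-]//].
  by exists (exist _ i Bi).
have [U [UU Ufree]] := free_ultrafilter infT.
have xi0 x : xi (k t) x @[t --> U] --> (0 : R).
  apply/cvgrPdist_lt => e e0.
  have fin : finite_set (sval @^-1` (lev @` [set k | e <= `|xi k x|]) : set T).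
    by apply: finite_preimage (xiv x e e0) => s t _ _; exact: eq_sig_hprop.
  apply: filterS (Ufree _ fin) => t nt; rewrite sub0r normrN ltNge.
  by apply/negP => et; apply: nt; exists (k t) => //; exact: (kE t).2.
have [tau [tau0 tauP]] := near_approximates UU (fun t => xile (k t)) xi0.
have [t [at_ Qt]] := filter_ex (filterI tauP (QU _ _ _ UU tau0)).
by have [[]] := kE t; exists (tau t).
Qed.

(** The requirement Q n asks for smallness at the first n points of a dense
    sequence.  Each functional has approximations meeting it up to some n,
    and for fixed n the functionals without one lie on finitely many levels.  If there is an approximation in Q n for every n, these tend to 0
    pointwise, so 0 is an approximation. *)
Lemma approximating_family (xi : K -> {scalar X}) :
  separable Y -> (forall k x, `|xi k x| <= r * `|x|) -> level_vanishing xi ->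
  exists tau : K -> {scalar Y},
    (forall k, approximates (xi k) (tau k)) /\ level_vanishing tau.
Proof.
move=> [D cD dD] xile xiv.
have [g ginj] := countable_injP _ cD.
pose Q n (tau : {scalar Y}) :=
  forall y, D y -> (g y < n)%N -> `|tau y| <= n.+1%:R^-1.
pose A n k := exists tau, approximates (xi k) tau /\ Q n tau.
have Qmono m n tau : (m <= n)%N -> Q n tau -> Q m tau.
  move=> mn Qn y Dy gy; apply: le_trans (Qn y Dy (leq_trans gy mn)) _.
  by rewrite lef_pV2 ?posrE// ler_nat.
have Amono m n k : (m <= n)%N -> A n k -> A m k.
  by move=> mn [tau [atau Qtau]]; exists tau; split => //; exact: Qmono Qtau.
have A0 k : A 0 k by have [tau ?] := exists_approximates (xile k); exists tau.
have finA n : finite_set (lev @` [set k | ~ A n k]).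
  apply: finite_levels_not_approximated => // T U tau UU tau0.
  have e0 : 0 < n.+1%:R^-1 :> R by rewrite invr_gt0.
  suff h m : \forall t \near U, forall y, D y -> (g y < m)%N ->
      `|tau t y| <= n.+1%:R^-1 by exact: h.
  elim: m => [|m IHm]; first exact: nearW.
  have [[z [Dz gz]]|nz] := pselect (exists z, D z /\ g z = m); last first.
    apply: filterS IHm => t IH y Dy; rewrite ltnS leq_eqVlt => /orP[/eqP gy|].
      by case: nz; exists y.
    exact: IH.
  have := tau0 z; move/cvgrPdist_le => /(_ _ e0) hz.
  apply: filterS2 IHm hz => t IH tz y Dy; rewrite ltnS leq_eqVlt => /orP[/eqP gy|].
    have -> : y = z by apply: ginj; rewrite ?inE// gz.
    by move: tz; rewrite sub0r normrN.
  exact: IH.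
have small y (e : R) : 0 < e -> exists n, forall tau : {scalar Y},
    (forall z, `|tau z| <= 2 * r * `|z|) -> Q n tau -> `|tau y| < e.
  move=> e0; pose d := e / (2 * (2 * r + 1)).
  have r1 : 0 < 2 * (2 * r + 1) by have := r0; lra.
  have d0 : 0 < d by rewrite divr_gt0.
  have dE : d * (2 * (2 * r + 1)) = e by rewrite /d divfK// gt_eqF.
  have [z [yz Dz]] : (ball y d `&` D) !=set0.
    by apply: dD; [exists y; exact: ballxx | exact: ball_open].
  rewrite -ball_normE /= in yz.
  (* n has to be past the code of z for Q n to speak of z, and larger than
     2 / e for the bound it gives. *)
  pose n := maxn (g z).+1 (Num.bound (2 / e)).
  exists n => tau taule Qtau.
  have tz : `|tau z| <= n.+1%:R^-1 by apply: Qtau => //; rewrite leq_max leqnn.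
  have ne : n.+1%:R^-1 < e / 2.
    rewrite -[e / 2]invrK invf_div ltf_pV2 ?posrE ?divr_gt0//.
    apply: lt_le_trans (archi_boundP _) _; first by rewrite divr_ge0 ?ltW.
    by rewrite ler_nat ltnW// ltnS leq_max leqnn orbT.
  have h : `|tau y| <= `|tau (y - z)| + `|tau z|.
    have -> : tau y = tau (y - z) + tau z by rewrite -linearD subrK.
    exact: ler_normD.
  have h2 := taule (y - z).
  have h3 : 2 * r * `|y - z| <= 2 * r * d by rewrite ler_wpM2l ?mulr_ge0// ltW.
  have tz2 := le_lt_trans tz ne.
  by clearbody d; move: h h2 h3 dE d0 tz2; lra.
have pick k : exists tau, approximates (xi k) tau /\
    forall n, ~ A n k \/ Q n tau.
  have [Ak|] := pselect (forall n, A n k); last first.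
    move=> /existsNP nA.
    have {}nA : exists n, `[< ~ A n k >] by case: nA => n nA; exists n; apply/asboolP.
    case: (ex_minnP nA) => -[/asboolP/(_ (A0 k))//|n] /asboolP nAn nmin.
    have [tau [atau Qtau]] : A n k.
      apply: contrapT => /asboolP/nmin; by rewrite ltnn.
    exists tau; split => // m; have [mn|nm] := leqP m n.
      by right; exact: Qmono Qtau.
    by left => /(Amono _ _ _ nm).
  have [phi _] := exists_approximates (xile k).
  pose zero : {scalar Y} := phi \- phi.
  have zeroE y : zero y = 0 by rewrite /zero /= subrr.
  exists zero; split; last by move=> n; right => y _ _; rewrite zeroE normr0.
  split=> [y|x]; first by rewrite zeroE normr0 !mulr_ge0.
  rewrite zeroE sub0r normrN; apply/ler_addgt0Pr => e e0.
  have [n nP] := small (f x) e e0; have [tau [[taule tauf] Qtau]] := Ak n.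
  have := nP tau taule Qtau; have := tauf x.
  by have := ler_norm (- xi k x); have := ler_norm (xi k x); rewrite !ltr_norml !ler_norml; lra.
have [tau tauP] := choice pick.
exists tau; split => [k|y e e0]; first exact: (tauP k).1.
have [n nP] := small y e e0.
apply: sub_finite_set (finA n) => _ [k /= ek <-]; exists k => //= Ank.
have [[taule _] /(_ n)[//|Qtau]] := tauP k.
by have := nP _ taule Qtau; rewrite ltNge ek.
Qed.
End Vanishing.

(** * Bounded operators *)

Lemma opnorm_bound {R : realType} {V W : normedModType R} (T : {linear V -> W}) :
  continuous T -> forall x, `|T x| <= opnorm T * `|x|.
Proof.
move=> /linear_bounded_continuous Tb x.
have [M [M0 TM]] : exists M, 0 <= M /\ forall z, `|z| <= 1 -> `|T z| <= M.
  have /linear_boundedP TM := Tb.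
  near (pinfty_nbhs R) => M.
  have M0 : 0 <= M by near: M; exact: nbhs_pinfty_ge.
  have TzM : forall z, `|T z| <= M * `|z| by near: M; exact: TM.
  exists M; split => // z z1; apply: le_trans (TzM z) _.
  by rewrite -[leRHS]mulr1 ler_wpM2l.
have [->|x0] := eqVneq x 0; first by rewrite linear0 !normr0 mulr0.
have nx : 0 < `|x| by rewrite normr_gt0.
rewrite -ler_pdivrMr//.
have -> : `|T x| / `|x| = `|T (`|x|^-1 *: x)|.
  by rewrite linearZ normrZ ger0_norm ?invr_ge0// mulrC.
apply: ub_le_sup; first by exists M => _ [z z1 <-]; exact: TM.
exists (`|x|^-1 *: x) => //=.
by rewrite normrZ ger0_norm ?invr_ge0// mulVf// gt_eqF.
Unshelve. all: by end_near.
Qed.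

Lemma opnorm_ge0 {R : realType} {V W : normedModType R} (T : {linear V -> W}) :
  0 <= opnorm T.
Proof.
have [supT|] := pselect (has_sup [set `|T x| | x in [set x : V | `|x| <= 1]]).
  apply: le_trans (ub_le_sup supT.2 _); last first.
    by exists 0 => //=; rewrite normr0.
  exact: normr_ge0.
by move=> nsup; rewrite /opnorm sup_out.
Qed.

Lemma opnorm_le {R : realType} {V W : normedModType R} (T : {linear V -> W}) (a : R) :
  0 <= a -> (forall x, `|T x| <= a * `|x|) -> opnorm T <= a.
Proof.
move=> a0 Ta; apply: ge_sup; first by exists `|T 0|, 0 => //=; rewrite normr0.
move=> _ [x /= x1 <-]; apply: le_trans (Ta x) _.
by rewrite -[leRHS]mulr1 ler_wpM2l.
Qed.

Lemma bounded_continuous {R : realType} {V W : normedModType R}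
    (T : {linear V -> W}) (a : R) :
  (forall x, `|T x| <= a * `|x|) -> continuous T.
Proof.
move=> Ta; apply/linear_bounded_continuous/linear_boundedP.
near=> M => x; apply: le_trans (Ta x) _; rewrite ler_wpM2r//.
Unshelve. all: by end_near.
Qed.

Lemma stable_map_of_bounded {R : realType} {X Y : normedModType R}
    (alpha gamma eps : R) (f : X -> Y) (T : {linear Y -> X}) :
  0 <= alpha -> (forall y, `|T y| <= alpha * `|y|) ->
  (forall x, `|T (f x) - x| <= gamma * eps) -> stable_map alpha gamma eps f.
Proof.
move=> a0 Ta Tf.
have [|TL TLE] := @linear_pack R (subspaceType (Defs.Lspace f)) X (fun u => T (ss_val u)).
  by move=> a u v; rewrite -linearP.
have TLa u : `|TL u| <= alpha * `|u| by rewrite TLE; exact: Ta.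
exists TL; split; [exact: bounded_continuous TLa|exact: opnorm_le|].
by move=> x; rewrite TLE; exact: Tf.
Qed.

Lemma linf_sum_map {R : realType} {Y : normedModType R} {I : Type}
    {E : I -> completeNormedModType R} (B : forall i, Y -> E i) (M : R) :
  (forall i, linear (B i)) -> (forall i y, `|B i y| <= M * `|y|) ->
  exists A : {linear Y -> linf_sum E}, forall y i, A y i = B i y.
Proof.
move=> Blin BM.
have bnd y : exists M, forall i, `|B i y| <= M by exists (M * `|y|).
have [|A AE] := @linear_pack R Y (linf_sum E) (fun y => LinfSum (bnd y)).
  by move=> a u v; apply: linf_sumP => i /=; rewrite Blin.
by exists A => y i; rewrite AE.
Qed.

Lemma c0_sum_map {R : realType} {Y : normedModType R} {I : Type}
    {E : I -> completeNormedModType R} (B : forall i, Y -> E i) (M : R) :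
  (forall i, linear (B i)) -> (forall i y, `|B i y| <= M * `|y|) ->
  (forall y e, 0 < e -> finite_set [set i | e <= `|B i y|]) ->
  exists A : {linear Y -> c0_sum E}, forall y i, ss_val (A y) i = B i y.
Proof.
move=> Blin BM Bv; have [A AE] := linf_sum_map Blin BM.
have vA y : A y \in cs_pred (c0_subspace E).
  apply/mem_set => e e0; apply: sub_finite_set (Bv y e e0) => i /=.
  by rewrite AE.
have [|A' A'E] := @linear_pack R Y (c0_sum E) (fun y => SubspaceType (vA y)).
  by move=> a u v; apply: val_inj => /=; rewrite linearP.
by exists A' => y i; rewrite A'E /= AE.
Qed.

(** * The three classes of spaces *)

Lemma isomorphism_of_BMdist_lt {R : realType} {X Z : normedModType R} (lam : R) :
  isomorphic X Z -> BMdist X Z < lam ->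
  exists (T : {linear X -> Z}) (S : {linear Z -> X}),
    isomorphism T S /\ opnorm T * opnorm S < lam.
Proof.
move=> [T0 [S0 iso0]] /inf_lt[|_ [T [S [iso ->]]] lt_lam]; last by exists T, S.
by exists (opnorm T0 * opnorm S0), T0, S0.
Qed.

(** An operator A into Z that almost recovers T is pulled back to X by S, which
    multiplies norm and error by s. *)
Lemma stable_map_through {R : realType} {X Y Z : normedModType R}
    (lam eps r s : R) (f : X -> Y) (T : {linear X -> Z}) (S : {linear Z -> X})
    (A : {linear Y -> Z}) :
  0 <= eps -> 0 <= r -> 0 <= s -> r * s <= lam -> cancel T S ->
  (forall z, `|S z| <= s * `|z|) -> (forall y, `|A y| <= 2 * r * `|y|) ->
  (forall x, `|A (f x) - T x| <= 4 * r * eps) ->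
  stable_map (2 * lam) (4 * lam) eps f.
Proof.
move=> eps0 r0 s0 rs TK Ss Ale Af; have rs0 := mulr_ge0 r0 s0.
apply: (@stable_map_of_bounded _ _ _ _ _ _ _ (S \o A)) => [|y|x] /=; first lra.
  apply: le_trans (Ss _) _; apply: le_trans (ler_wpM2l s0 (Ale y)) _.
  by rewrite mulrA ler_wpM2r//; lra.
rewrite -[X in _ - X]TK -linearB.
apply: le_trans (Ss _) _; apply: le_trans (ler_wpM2l s0 (Af x)) _.
by rewrite mulrA ler_wpM2r//; lra.
Qed.

(** Inside one block the levels are the points of G i; the norm bounds are
    uniform in i, so the blocks assemble into the l_infinity-sum with no
    vanishing condition across blocks. *)
Lemma stable_map_into_c0_blocks {R : realType} {X Y : completeNormedModType R}
    {I : Type} {G : I -> Type} (lam eps : R) (f : X -> Y)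
    (T : {linear X -> linf_sum (fun i => c0 R (G i))})
    (S : {linear linf_sum (fun i => c0 R (G i)) -> X}) (r s : R) :
  separable Y -> 0 <= eps -> eps_isometry eps f -> standard f ->
  0 <= r -> 0 <= s -> r * s <= lam -> cancel T S ->
  (forall x, `|T x| <= r * `|x|) -> (forall z, `|S z| <= s * `|z|) ->
  stable_map (2 * lam) (4 * lam) eps f.
Proof.
move=> Ysep eps0 fe f0 r0 s0 rs TK Tr Ss.
have block i : exists tau : G i -> {scalar Y},
    [/\ forall g y, `|tau g y| <= 2 * r * `|y|,
        forall g x, `|tau g (f x) - ss_val (T x i) g| <= 4 * r * eps &
        forall y e, 0 < e -> finite_set [set g | e <= `|tau g y|]].
  have xiP g : exists xi : {scalar X}, forall x, xi x = ss_val (T x i) g.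
    by apply: scalar_pack => a u v; rewrite linearP.
  have [xi xiE] := choice xiP.
  have [|x e e0|tau [tauP tauv]] := approximating_family (lev := id) eps0 r0 fe f0 (xi := xi) Ysep.
  - move=> g x; rewrite xiE; apply: le_trans (Tr x).
    exact: le_trans (li_norm_ub (ss_val (T x i)) g) (li_norm_ub (T x) i).
  - rewrite image_id; have := set_mem (ss_valP (T x i)) e e0.
    by apply: sub_finite_set => g /=; rewrite xiE.
  exists tau; split=> [g y|g x|y e e0]; first exact: (tauP g).1.
    by rewrite -xiE; exact: (tauP g).2.
  by have := tauv y e e0; rewrite image_id.
pose tau i := projT1 (cid (block i)); pose tauP i := projT2 (cid (block i)).
have comp i : exists B : {linear Y -> c0 R (G i)},
    forall y g, ss_val (B y) g = tau i g y.
  have [tau1 tau2 tau3] := tauP i.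
  apply: (c0_sum_map (E := fun _ : G i => R^o) (B := fun g y => tau i g y)
    (M := 2 * r)) => //.
  by move=> g; exact: linearP.
pose B i := projT1 (cid (comp i)); pose BE i := projT2 (cid (comp i)).
have Ble i y : `|B i y| <= 2 * r * `|y|.
  apply: li_norm_le => [|g]; first by rewrite !mulr_ge0.
  by rewrite BE; have [tau1 _ _] := tauP i; exact: tau1.
have [A AE] := linf_sum_map (B := B) (fun i => linearP (B i)) Ble.
apply: (stable_map_through (A := A) eps0 r0 s0 rs TK Ss) => [y|x].
  apply: li_norm_le => [|i]; first by rewrite !mulr_ge0.
  by rewrite AE; exact: Ble.
apply: li_norm_le => [|i]; first by rewrite !mulr_ge0.
apply: li_norm_le => [|g]; first by rewrite !mulr_ge0.
have -> : ss_val ((A (f x) - T x) i) g = tau i g (f x) - ss_val (T x i) g.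
  by rewrite -BE -AE.
by have [_ tau2 _] := tauP i; exact: tau2.
Qed.

(** Here a level is an index i of the c_0-sum and carries the coordinates of
    U i in l_infinity(J i).  Vanishing uniformly over J i is what makes
    |B i y| tend to 0 in the norm of l_infinity(J i), and P i preserves it. *)
Lemma stable_map_into_linf_blocks {R : realType} {X Y : completeNormedModType R}
    {I : Type} {E : I -> completeNormedModType R} {J : I -> Type}
    (lam eps : R) (f : X -> Y)
    (T : {linear X -> c0_sum E}) (S : {linear c0_sum E -> X})
    (U : forall i, {linear E i -> linf R (J i)})
    (P : forall i, {linear linf R (J i) -> E i}) (r s l : R) :
  separable Y -> 0 <= eps -> eps_isometry eps f -> standard f ->
  0 <= r -> 0 <= s -> 0 <= l -> r * l * s <= lam -> cancel T S ->
  (forall x, `|T x| <= r * `|x|) -> (forall z, `|S z| <= s * `|z|) ->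
  (forall i, cancel (U i) (P i)) -> (forall i e, `|U i e| <= `|e|) ->
  (forall i w, `|P i w| <= l * `|w|) ->
  stable_map (2 * lam) (4 * lam) eps f.
Proof.
move=> Ysep eps0 fe f0 r0 s0 l0 rls TK Tr Ss UK Ule Ple.
pose K := {i : I & J i}.
have xiP (k : K) : exists xi : {scalar X},
    forall x, xi x = U (tag k) (ss_val (T x) (tag k)) (tagged k).
  by apply: scalar_pack => a u v; rewrite !linearP.
have [xi xiE] := choice xiP.
have [k x|x e e0|tau [tauP tauv]] :=
    approximating_family (lev := @projT1 I J) eps0 r0 fe f0 (xi := xi) Ysep.
- rewrite xiE; apply: le_trans (Tr x).
  apply: le_trans (li_norm_ub (U _ _) (tagged k)) _; apply: le_trans (Ule _ _) _.
  exact: (li_norm_ub (ss_val (T x))).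
- have := set_mem (ss_valP (T x)) e e0; apply: sub_finite_set => _ [k /= ek <-].
  apply: le_trans ek _; rewrite xiE.
  exact: le_trans (li_norm_ub (U _ _) (tagged k)) (Ule _ _).
have comp i : exists B : {linear Y -> linf R (J i)},
    forall y j, B y j = tau (existT _ i j) y.
  apply: (linf_sum_map (E := fun _ : J i => R^o)
    (B := fun j y => tau (existT _ i j) y) (M := 2 * r)).
    by move=> j; exact: linearP.
  by move=> j; exact: (tauP _).1.
pose B i := projT1 (cid (comp i)); pose BE i := projT2 (cid (comp i)).
have Ble i y : `|B i y| <= 2 * r * `|y|.
  apply: li_norm_le => [|j]; first by rewrite !mulr_ge0.
  by rewrite BE; exact: (tauP _).1.
have [|||A AE] := @c0_sum_map _ _ _ _ (fun i => P i \o B i) (2 * (r * l)).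
- by move=> i; exact: linearP.
- move=> i y /=; apply: le_trans (Ple i _) _.
  by apply: le_trans (ler_wpM2l l0 (Ble i y)) _; lra.
- move=> y e e0; have l1 : 0 < l + 1 by lra.
  have d0 : 0 < e / (l + 1) by rewrite divr_gt0.
  apply: sub_finite_set (tauv y _ d0) => i /= ei.
  apply: contrapT => ni.
  have Bd : `|B i y| <= e / (l + 1).
    apply: li_norm_le => [|j]; first exact: ltW.
    rewrite BE leNgt; apply/negP => dj; apply: ni.
    by exists (existT _ i j) => //=; exact: ltW.
  have := le_trans ei (le_trans (Ple i _) (ler_wpM2l l0 Bd)).
  by rewrite mulrA ler_pdivlMr// mulrDr mulr1 mulrC; lra.
have rl0 : 0 <= r * l by exact: mulr_ge0.
apply: (stable_map_through (A := A) eps0 rl0 s0 rls TK Ss) => [y|x].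
  apply: li_norm_le => [|i]; first by rewrite !mulr_ge0.
  rewrite AE /=; apply: le_trans (Ple i _) _.
  by apply: le_trans (ler_wpM2l l0 (Ble i y)) _; lra.
apply: li_norm_le => [|i]; first by rewrite !mulr_ge0.
have -> : ss_val (A (f x) - T x) i =
    P i (B i (f x) - U i (ss_val (T x) i)).
  by rewrite linearB UK; rewrite -[P i (B i (f x))]AE.
apply: le_trans (Ple i _) _.
have -> : 4 * (r * l) * eps = l * (4 * r * eps) by ring.
apply: ler_wpM2l => //; apply: li_norm_le => [|j]; first by rewrite !mulr_ge0.
have -> : (B i (f x) - U i (ss_val (T x) i)) j =
    tau (existT _ i j) (f x) - U i (ss_val (T x) i) j by rewrite -BE.
by have := (tauP (existT _ i j)).2 x; rewrite xiE.
Qed.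

Definition dual_ball {R : realType} (V : normedModType R) : Type :=
  {phi : {scalar V} | forall x, `|phi x| <= `|x|}.

(** Evaluation embeds E isometrically into the bounded functions on its dual
    ball; the projection onto the image, read back in E, is the retraction. *)
Lemma injective_space_retract_of_linf {R : realType} (lam : R)
    (E : completeNormedModType R) : injective_space lam E ->
  exists (U : {linear E -> linf R (dual_ball E)})
         (P : {linear linf R (dual_ball E) -> E}),
    [/\ cancel U P, forall e, `|U e| <= `|e| & forall w, `|P w| <= lam * `|w|].
Proof.
move=> injE.
have [||U UE] := @linf_sum_map _ E (dual_ball E) (fun=> R^o)
  (fun phi x => sval phi x) 1.
- by move=> phi; exact: linearP.
- by move=> phi x; rewrite mul1r; exact: (svalP phi).
have Ule e : `|U e| <= `|e|.
  by apply: li_norm_le => // phi; rewrite UE; exact: (svalP phi).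
have Uiso e : `|U e| = `|e|.
  apply/eqP; rewrite eq_le Ule/=.
  have [phi [phile phie]] := norming_functional e.
  have := li_norm_ub (U e) (exist _ phi phile : dual_ball E).
  by rewrite UE /= phie; apply: le_trans; exact: ler_norm.
have [p [pc plam pp prange]] := injE _ U Uiso.
have Uinj : injective U.
  move=> x y xy; apply/eqP; rewrite -subr_eq0 -normr_eq0 -Uiso linearB xy subrr.
  by rewrite normr0.
have ex w : exists e, U e = p w.
  by have : range p (p w) by [exists w]; rewrite prange => -[e _ <-]; exists e.
have [P0 P0E] := choice ex.
have [|P PE] := @linear_pack _ _ _ P0.
  by move=> a u v; apply: Uinj; rewrite linearP !P0E linearP.
exists U, P; split => // [e|w].
  apply: Uinj; rewrite PE P0E; have : range U (U e) by [].
  by rewrite -prange => -[w _ <-]; rewrite pp.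
rewrite PE -Uiso P0E; apply: le_trans (opnorm_bound pc w) _.
by rewrite ler_wpM2r.
Qed.

Theorem theorem5p1 (R : realType) (Lambda : Type) (Gamma : Lambda -> Type)
    (X : completeNormedModType R) (lam : R) (lam_gt0 : 0 < lam)
    (hX :
      (let Z := linf_sum (fun i => c0 R (Gamma i)) in
       isomorphic X Z /\ BMdist X Z < lam)
      \/
      (let Z := c0_sum (fun i => linf R (Gamma i)) in
       isomorphic X Z /\ BMdist X Z < lam)
      \/
      (exists E : Lambda -> completeNormedModType R,
         (forall i, injective_space lam (E i)) /\ isometric X (c0_sum E)))
    (Y : completeNormedModType R) (Y_sep : separable Y) :
  stable_pair (2 * lam) (4 * lam) X Y.
Proof.
move=> eps eps0 f fe f0.
case: hX => [[iso dlt]|[[iso dlt]|[E [injE [T [S [TK SK Tiso]]]]]]].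
- have [T [S [[TK _ Tc Sc] lt_lam]]] := isomorphism_of_BMdist_lt iso dlt.
  exact: (stable_map_into_c0_blocks Y_sep eps0 fe f0 (opnorm_ge0 T) (opnorm_ge0 S)
    (ltW lt_lam) TK (opnorm_bound Tc) (opnorm_bound Sc)).
- have [T [S [[TK _ Tc Sc] lt_lam]]] := isomorphism_of_BMdist_lt iso dlt.
  apply: (stable_map_into_linf_blocks (U := fun i => idfun) (P := fun i => idfun)
    Y_sep eps0 fe f0 (opnorm_ge0 T) (opnorm_ge0 S) ler01 _ TK (opnorm_bound Tc)
    (opnorm_bound Sc)) => //=; first by rewrite mulr1 ltW.
  by move=> i w; rewrite mul1r.
pose H i := cid (injective_space_retract_of_linf (injE i)).
pose H' i := cid (projT2 (H i)); pose HP i := projT2 (H' i).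
apply: (stable_map_into_linf_blocks (U := fun i => projT1 (H i))
    (P := fun i => projT1 (H' i)) (T := T) (S := S) (r := 1) (s := 1) (l := lam)
    Y_sep eps0 fe f0) => //.
- exact: ltW.
- by rewrite mul1r mulr1.
- by move=> x; rewrite Tiso mul1r.
- by move=> z; rewrite mul1r -Tiso SK.
- by move=> i; case: (HP i).
- by move=> i; case: (HP i).
- by move=> i; case: (HP i).
Qed.
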